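(* Let $E,F\subseteq\mathbb{R}^n$ be Lebesgue measurable sets with finite positive measure. Suppose there exist $n_1,n_2\in\mathbb{Z}^{n}$ and $k_1,k_2\in\mathbb{Z}$ such that, modulo null sets, \[ 2^{k_1}F\subseteq E+2n_1\pi \quad\text{and}\quad E+2n_2\pi\subseteq 2^{k_2}F, \] and $(E+2n_2\pi)\cap 2^{k_1}F$ is a null set. Then there exists a Lebesgue measurable set $G\subseteq (E+2n_2\pi)\cup 2^{k_1}F$ such that $G$ is both $2\pi$-translation congruent to $E$ and $2$-dilation congruent to $F$. In fact $G$ can be taken as \[ G=\Big(\bigcup_{i=0}^{\infty}S^i\big(2^{k_1}F\setminus 2^{k_1-k_2}(E+2n_2\pi)\big)\Big)\ \cup\ \Big((E+2n_2\pi)\setminus\bigcup_{i=1}^{\infty}2^{k_2-k_1}\cdot S^i\big(2^{k_1}F\setminus 2^{k_1-k_2}(E+2n_2\pi)\big)\Big), \] where $S(x)=2^{k_1-k_2}\big(x+2(n_2-n_1)\pi\big)$ for all $x\in\mathbb{R}^n$.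
   Context: Inclusions and equalities of sets are understood modulo Lebesgue null sets. For $c\in\mathbb{R}$, $v\in\mathbb{R}^n$ and $A\subseteq\mathbb{R}^n$, $cA=\{cx:x\in A\}$ and $A+v=\{x+v:x\in A\}$; $S^i$ is the $i$-fold iterate of $S$ ($S^0=\mathrm{id}$). A countable family of measurable sets $\{E_j\}$ is a measurable partition of $E$ if $E\,\Delta\,\bigcup_jE_j$ is null and $E_i\cap E_j$ is null for $i\ne j$. Measurable sets $A,B\subseteq\mathbb{R}^n$ are $2\pi$-translation congruent if there is a measurable partition $\{A_v\}_{v\in\mathbb{Z}^n}$ of $A$ such that $\{A_v+2\pi v\}_{v\in\mathbb{Z}^n}$ is a measurable partition of $B$. They are $2$-dilation congruent if there is a measurable partition $\{A_j\}_{j\in\mathbb{Z}}$ of $A$ such that $\{2^jA_j\}_{j\in\mathbb{Z}}$ is a measurable partition of $B$. *)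

(* Defs.v *)
From HB Require Import structures.
From mathcomp Require Import all_boot all_order all_algebra.
From mathcomp Require Import all_classical all_reals all_analysis.

Set Implicit Arguments.
Unset Strict Implicit.
Unset Printing Implicit Defensive.
Import Order.TTheory GRing.Theory Num.Theory.
Import numFieldNormedType.Exports.
Local Open Scope classical_set_scope.
Local Open Scope ring_scope.

(** The library has no Lebesgue measure on [R^n]: it is obtained here by the
    Caratheodory construction from the volume of boxes. *)

Definition box (R : realType) (n : nat) (a b : 'rV[R]_n) : set 'rV[R]_n :=
  [set x | forall i, a 0 i <= x 0 i < b 0 i].

Definition box_vol (R : realType) (n : nat) (a b : 'rV[R]_n) : R :=
  \prod_(i < n) Num.max 0 (b 0 i - a 0 i).

(** Covers are indexed by subsets [D] of [nat], so that they may be finite: for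
    [n = 0] every box has volume 1, and the empty set is to be covered by
    no box. *)
Definition lebesgue_outer (R : realType) (n : nat) (A : set 'rV[R]_n) : \bar R :=
  ereal_inf [set s | exists (D : set nat) (a b : nat -> 'rV[R]_n),
    A `<=` \bigcup_(k in D) box (a k) (b k) /\
    s = \esum_(k in D) (box_vol (a k) (b k))%:E].

Section lebesgue_outer_is_outer_measure.
Local Open Scope ereal_scope.
Context (R : realType) (n : nat).

Lemma box_vol_ge0 (a b : 'rV[R]_n) : 0 <= (box_vol a b)%:E.
Proof. by rewrite lee_fin; apply: prodr_ge0 => i _; rewrite le_max lexx. Qed.

Lemma lebesgue_outer_ge0 (A : set 'rV[R]_n) : 0 <= lebesgue_outer A.
Proof.
apply: le_ereal_inf_tmp => _ [D [a [b [_ ->]]]].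
by apply: esum_ge0 => k _; exact: box_vol_ge0.
Qed.

Lemma lebesgue_outer0 : lebesgue_outer (set0 : set 'rV[R]_n) = 0.
Proof.
apply/eqP; rewrite eq_le lebesgue_outer_ge0 andbT.
apply: ereal_inf_lbound; exists set0, (fun=> 0%R), (fun=> 0%R).
by rewrite esum_set0; split.
Qed.

Lemma lebesgue_outer_subset_sigma_subadditive A (F : nat -> set 'rV[R]_n) :
  subset_sigma_subadditive (@lebesgue_outer R n) A F.
Proof.
move=> AF; have [[i ioo]|] := pselect (exists i, lebesgue_outer (F i) = +oo).
  rewrite (eseries_pinfty _ _ ioo) ?leey// => k _.
  by rewrite -ltNye (lt_le_trans _ (lebesgue_outer_ge0 _)).
rewrite -forallNE => Foo.
apply/lee_addgt0Pr => _/posnumP[e].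
rewrite (le_trans _ (epsilon_trick _ _ _))//; last first.
  by move=> k; exact: lebesgue_outer_ge0.
pose P i (c : set nat * (nat -> 'rV[R]_n) * (nat -> 'rV[R]_n)) :=
  F i `<=` \bigcup_(k in c.1.1) box (c.1.2 k) (c.2 k) /\
  \esum_(k in c.1.1) (box_vol (c.1.2 k) (c.2 k))%:E <=
    lebesgue_outer (F i) + (e%:num / (2 ^ i.+1)%:R)%:E.
have [G PG] : {G & forall i, P i (G i)}.
  apply: (@choice _ _ P) => i; rewrite /P.
  have Ffin : lebesgue_outer (F i) \is a fin_num.
    by rewrite ge0_fin_numE ?lebesgue_outer_ge0// ltey; apply/eqP/Foo.
  have en1 : (0 < e%:num / (2 ^ i.+1)%:R)%R by [].
  have [_ [D [a [b [FD ->]]]] /ltW le] := lb_ereal_inf_adherent en1 Ffin.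
  by exists (D, a, b).
pose D := (@pickle (nat * nat)%type) @` (setT `*`` (fun i => (G i).1.1)).
pose a k := if unpickle k is Some p then (G p.1).1.2 p.2 else 0%R.
pose b k := if unpickle k is Some p then (G p.1).2 p.2 else 0%R.
apply: (@le_trans _ _ (\esum_(k in D) (box_vol (a k) (b k))%:E)).
  apply: ereal_inf_lbound; exists D, a, b; split => //.
  move=> x /AF[i _ /(PG i).1[j Dj xj]].
  by exists (pickle (i, j)); [exists (i, j)|rewrite /a /b pickleK].
rewrite esum_image; last by move=> p q _ _; exact: (pcan_inj pickleK).
under eq_esum do rewrite /a /b pickleK.
rewrite -(@esum_esum _ _ _ _ _
  (fun i j => (box_vol ((G i).1.2 j) ((G i).2 j))%:E)); last first.
  by move=> i j _ _; exact: box_vol_ge0.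
rewrite nneseries_esumT; last first.
  by move=> i; rewrite adde_ge0 ?lebesgue_outer_ge0.
by apply: le_esum => i _; exact: (PG i).2.
Qed.

HB.instance Definition _ := isSubsetOuterMeasure.Build R 'rV[R]_n
  (@lebesgue_outer R n) lebesgue_outer0 lebesgue_outer_ge0
  lebesgue_outer_subset_sigma_subadditive.

End lebesgue_outer_is_outer_measure.

(** The bundled outer measure; the instances of a sigma-algebra and of a measure on
    [caratheodory_type] are only found for the bundled form. *)
Definition outer_rV (R : realType) (n : nat) :
  {outer_measure set 'rV[R]_n -> \bar R} := @lebesgue_outer R n.

Definition lebesgue_measurable (R : realType) (n : nat) : set (set 'rV[R]_n) :=
  (outer_rV R n).-cara.-measurable.

Definition lebesgue_rV (R : realType) (n : nat) :
    {measure set (caratheodory_type (outer_rV R n)) -> \bar R} :=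
  outer_rV R n : set (caratheodory_type (outer_rV R n)) -> \bar R.

(** [lebesgue_rV] is complete, so this is the same as being Lebesgue measurable
    of measure zero, i.e. [lebesgue_outer A = 0]. *)
Definition lebesgue_null (R : realType) (n : nat) (A : set 'rV[R]_n) : Prop :=
  (lebesgue_rV R n).-negligible A.

Definition ae_subset (R : realType) (n : nat) (A B : set 'rV[R]_n) : Prop :=
  lebesgue_null (A `\` B).

Definition dilate (R : realType) (n : nat) (c : R) (A : set 'rV[R]_n) :
  set 'rV[R]_n := [set c *: x | x in A].

Definition translate (R : realType) (n : nat) (v : 'rV[R]_n) (A : set 'rV[R]_n) :
  set 'rV[R]_n := [set x + v | x in A].

Definition twopi (R : realType) (n : nat) (v : 'rV[int]_n) : 'rV[R]_n :=
  (2 * pi) *: map_mx (fun z : int => z%:~R) v.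

Definition measurable_partition (R : realType) (n : nat) (I : countType)
    (P : I -> set 'rV[R]_n) (A : set 'rV[R]_n) : Prop :=
  [/\ forall i, lebesgue_measurable (P i),
      lebesgue_null (A `+` \bigcup_i P i) &
      forall i j, i != j -> lebesgue_null (P i `&` P j)].

(** Measurability of [A] and [B] is not repeated here: it follows from the
    existence of measurable partitions. *)
Definition translation_congruent (R : realType) (n : nat)
    (A B : set 'rV[R]_n) : Prop :=
  exists P : 'rV[int]_n -> set 'rV[R]_n,
    measurable_partition P A /\
    measurable_partition (fun v => translate (twopi R v) (P v)) B.

Definition dilation_congruent (R : realType) (n : nat)
    (A B : set 'rV[R]_n) : Prop :=
  exists P : int -> set 'rV[R]_n,
    measurable_partition P A /\
    measurable_partition (fun j => dilate (2 ^ j) (P j)) B.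

(* Main.v *)
(** Write [A = E + 2 n2 pi], [B = 2^k1 F], [c = 2^(k1 - k2)] and let [t] be the
    translation by [2 (n2 - n1) pi], so that [t B] lies in [A], [c A] lies in [B]
    and [S x = c (t x)].  With [C = B \ c A], the union [D] of the sets [S^i C]
    lies in [B] and satisfies [D = C U c (t D)], while the dilates removed from [A]
    in [G] add up to [t D], so that [G = D U (A \ t D)], as in a
    Cantor-Schroeder-Bernstein argument.  Translating the piece [D] by [t]
    completes [A \ t D] to [A]; scaling the piece [A \ t D] by [c] gives
    [c A \ c (t D)], which completes [D] to [C U c A = B]. *)

Require Import Defs.
From mathcomp Require Import all_boot all_order all_algebra.
From mathcomp Require Import all_classical all_reals all_analysis.
Import Order.TTheory GRing.Theory Num.Theory.
Import numFieldNormedType.Exports.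
Local Open Scope classical_set_scope.
Local Open Scope ring_scope.

(** Each finite partial sum on the left is [K] times a finite partial sum of [a], and the full sum
    of [a] bounds the latter. *)
Lemma le_esumZl {R : realType} {T : choiceType} (D : set T) (K : R)
    (a : T -> \bar R) :
  0 <= K -> (forall i, 0 <= a i)%E ->
  (\esum_(i in D) (K%:E * a i) <= K%:E * \esum_(i in D) a i)%E.
Proof.
move=> K0 a0; apply: ge_ereal_sup => _ [X DX <-].
rewrite -ge0_mule_fsumr//; apply: lee_pmul => //.
  by rewrite fsume_ge0.
by apply: esum_ge; exists X.
Qed.

(** * Behaviour of Lebesgue measure under positive scalings and translations *)

Section affine_maps.
Context {R : realType} {n : nat}.
Implicit Types (c : R) (v : 'rV[R]_n) (A B : set 'rV[R]_n).

(** Translating before scaling makes the map [S] of the theorem an instance by definition;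
    translations are the case [c = 1] and dilations the case [v = 0]. *)
Definition affine c v (x : 'rV[R]_n) : 'rV[R]_n := c *: (x + v).

Lemma affineK c v : c != 0 -> cancel (affine c v) (affine c^-1 (- (c *: v))).
Proof.
by move=> c0 x; rewrite /affine -scalerBr addrK scalerA mulVf// scale1r.
Qed.

Lemma affineKV c v : c != 0 -> cancel (affine c^-1 (- (c *: v))) (affine c v).
Proof.
by move=> c0 x; rewrite /affine scalerDr scalerA mulfV// scale1r subrK.
Qed.

(** As preimages under the inverse map, images commute with all Boolean operations by mere
    computation. *)
Lemma affine_imageE c v A : c != 0 ->
  affine c v @` A = affine c^-1 (- (c *: v)) @^-1` A.
Proof.
move=> c0; apply/seteqP; split=> [_ [x Ax <-]|y Ay]; first by rewrite /= affineK.
by exists (affine c^-1 (- (c *: v)) y) => //; rewrite affineKV.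
Qed.

Lemma affine_imageKV c v A : c != 0 ->
  affine c v @` (affine c^-1 (- (c *: v)) @` A) = A.
Proof.
by move=> c0; rewrite image_comp; apply: eq_image_id => x _ /=; rewrite affineKV.
Qed.

Lemma box_vol_affine c v (a b : 'rV[R]_n) : 0 <= c ->
  box_vol (affine c v a) (affine c v b) = c ^+ n * box_vol a b.
Proof.
move=> c0; rewrite /box_vol -[in c ^+ n](card_ord n) -prodr_const -big_split/=.
apply: eq_bigr => i _; rewrite !mxE -mulrBr opprD addrACA subrr addr0.
by rewrite maxr_pMr// mulr0.
Qed.

Lemma affine_box c v (a b x : 'rV[R]_n) : 0 < c ->
  box a b x -> box (affine c v a) (affine c v b) (affine c v x).
Proof.
by move=> c0 abx i; have := abx i;
rewrite !mxE ler_pM2l// ltr_pM2l// lerD2r ltrD2r.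
Qed.

(** A cover of [A] by boxes is mapped to a cover of the image by boxes whose volumes are multiplied
    by [c ^+ n]. *)
Lemma outer_affine_le c v A : 0 < c ->
  (lebesgue_outer (affine c v @` A) <= (c ^+ n)%:E * lebesgue_outer A)%E.
Proof.
move=> c0; have cn0 : 0 < c ^+ n by exact: exprn_gt0.
rewrite -lee_pdivrMl//; apply: le_ereal_inf_tmp => _ [D [a [b [AD ->]]]].
rewrite lee_pdivrMl//.
apply: (@le_trans _ _
    (\esum_(k in D) (box_vol (affine c v (a k)) (affine c v (b k)))%:E)%E).
  apply: ereal_inf_lbound; exists D, (affine c v \o a), (affine c v \o b).
  split => //.
  by move=> _ [x /AD [k Dk xk] <-]; exists k => //; exact: affine_box.
under eq_esum do rewrite box_vol_affine ?(ltW c0)// EFinM.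
by apply: le_esumZl => [|k]; [exact: ltW|exact: box_vol_ge0].
Qed.

Lemma outer_affine c v A : 0 < c ->
  lebesgue_outer (affine c v @` A) = ((c ^+ n)%:E * lebesgue_outer A)%E.
Proof.
move=> c0; apply/eqP; rewrite eq_le outer_affine_le//=.
have cV0 : 0 < c^-1 by rewrite invr_gt0.
have cN0 : c != 0 by rewrite gt_eqF.
rewrite -lee_pdivlMl ?exprn_gt0// -exprVn.
(* The reverse inequality is the one already proved, applied to the inverse map. *)
apply: le_trans (outer_affine_le _ (- (c *: v)) _ cV0).
rewrite image_comp (_ : _ @` A = A)//.
by apply: eq_image_id => x _ /=; rewrite affineK.
Qed.

(** In the Caratheodory criterion every test set is the image of another one, and all three outer
    measures are scaled by the same [c ^+ n]. *)
Lemma measurable_affine c v A : 0 < c ->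
  lebesgue_measurable A -> lebesgue_measurable (affine c v @` A).
Proof.
move=> c0 mA; have cN0 : c != 0 by rewrite gt_eqF.
move=> X /=; have [Y ->] : exists Y, X = affine c v @` Y.
  by exists (affine c^-1 (- (c *: v)) @` X); rewrite affine_imageKV.
rewrite (_ : ~` _ = affine c v @` (~` A)); last by rewrite !affine_imageE.
have fI Z : affine c v @` Y `&` affine c v @` Z = affine c v @` (Y `&` Z).
  by rewrite !affine_imageE.
rewrite !fI !outer_affine// -ge0_muleDr ?lebesgue_outer_ge0//.
by congr (_ * _)%E; exact: mA.
Qed.

Lemma null_affine c v A : 0 < c ->
  lebesgue_null A -> lebesgue_null (affine c v @` A).
Proof.
move=> c0 [N [mN N0 AN]]; exists (affine c v @` N); split.
- exact: measurable_affine.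
- rewrite /= in N0 *; rewrite outer_affine//.
  by transitivity ((c ^+ n)%:E * 0 : \bar R)%E; [congr (_ * _)%E|rewrite mule0].
- exact: image_subset.
Qed.

Lemma ae_subset_affine c v A B : 0 < c ->
  ae_subset A B -> ae_subset (affine c v @` A) (affine c v @` B).
Proof.
move=> c0 AB; have := null_affine c v _ c0 AB; apply: negligibleS.
by have cN0 : c != 0 by [rewrite gt_eqF]; rewrite !affine_imageE.
Qed.

Lemma translateE v A : translate v A = affine 1 v @` A.
Proof. by apply: eq_imagel => x _; rewrite /affine scale1r. Qed.

Lemma dilateE c A : dilate c A = affine c 0 @` A.
Proof. by apply: eq_imagel => x _; rewrite /affine addr0. Qed.

End affine_maps.

(** * Inclusions modulo null sets and partitions into two pieces *)

Section ae_inclusion.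
Context {R : realType} {n : nat}.
Implicit Types A B D X Y : set 'rV[R]_n.

Lemma subset_ae_subset A B : A `<=` B -> ae_subset A B.
Proof. by rewrite /ae_subset -setD_eq0 => ->; exact: negligible_set0. Qed.

Lemma ae_subset_trans A B D : ae_subset A B -> ae_subset B D -> ae_subset A D.
Proof.
move=> AB BD; apply: negligibleS (negligibleU AB BD) => x [Ax nDx].
by have [Bx|nBx] := pselect (B x); [right|left].
Qed.

Lemma ae_subsetU A B D :
  ae_subset A D -> ae_subset B D -> ae_subset (A `|` B) D.
Proof. by move=> AD BD; rewrite /ae_subset setDUl; exact: negligibleU. Qed.

Lemma bigcup_ae_subset (A : nat -> set 'rV[R]_n) B :
  (forall i, ae_subset (A i) B) -> ae_subset (\bigcup_i A i) B.
Proof.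
by move=> AB; rewrite /ae_subset setDE setI_bigcupl; exact: negligible_bigcup.
Qed.

Lemma ae_subset_setY A B :
  ae_subset A B -> ae_subset B A -> lebesgue_null (A `+` B).
Proof. by move=> AB BA; exact: negligibleU. Qed.

(** A union of cases rather than a nested conditional, so that both pieces survive
    when [i1 = i2]. *)
Definition two_pieces {I : Type} (i1 i2 : I) X Y (i : I) : set 'rV[R]_n :=
  [set x | i = i1 /\ X x \/ i = i2 /\ Y x].

Lemma image_two_pieces {I : Type} (f : I -> 'rV[R]_n -> 'rV[R]_n) (i1 i2 : I) X Y i :
  f i @` two_pieces i1 i2 X Y i = two_pieces i1 i2 (f i1 @` X) (f i2 @` Y) i.
Proof.
apply/seteqP; split=> [_ [x [[-> Xx]|[-> Yx]] <-]|x].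
- by left; split => //; exists x.
- by right; split => //; exists x.
by case=> -[-> [z zXY <-]]; exists z => //; [left|right].
Qed.

Lemma measurable_two_pieces (I : countType) (i1 i2 : I) X Y A :
  lebesgue_measurable X -> lebesgue_measurable Y -> lebesgue_null (X `&` Y) ->
  lebesgue_null (A `+` (X `|` Y)) -> measurable_partition (two_pieces i1 i2 X Y) A.
Proof.
move=> mX mY XY AXY; split.
- move=> i.
  have -> : two_pieces i1 i2 X Y i =
      (if i == i1 then X else set0) `|` (if i == i2 then Y else set0).
    by apply/seteqP; split=> x; rewrite /two_pieces/=;
      case: eqVneq => [<-|/eqP ne1]; case: eqVneq => [<-|/eqP ne2] /=; tauto.
  by apply: measurableU; case: ifP => // _; exact: measurable0.
- rewrite (_ : \bigcup_i _ = X `|` Y)//; apply/seteqP; split.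
    by move=> x [i _ [[_ Xx]|[_ Yx]]]; [left|right].
  by move=> x [Xx|Yx]; [exists i1 => //; left|exists i2 => //; right].
(* For distinct indices, a common point cannot come from [X] twice or from [Y] twice, so it lies in
   both [X] and [Y]. *)
- move=> i j /eqP ij; apply: negligibleS XY => x.
  by move=> [[[ei Xx]|[ei Yx]] [[ej Xx']|[ej Yx']]]; split => //;
  case: ij; rewrite ei ej.
Qed.

End ae_inclusion.

(** * Translations, dilations and congruences realised by two pieces *)

Section translations_and_dilations.
Context {R : realType} {n : nat}.
Implicit Types (c : R) (A B X Y : set 'rV[R]_n).

Lemma measurable_translate (v : 'rV[R]_n) A :
  lebesgue_measurable A -> lebesgue_measurable (translate v A).
Proof. by rewrite translateE; exact: measurable_affine. Qed.

Lemma measurable_dilate c A : 0 < c ->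
  lebesgue_measurable A -> lebesgue_measurable (dilate c A).
Proof. by rewrite dilateE; exact: measurable_affine. Qed.

Lemma ae_subset_translate (v : 'rV[R]_n) A B :
  ae_subset A B -> ae_subset (translate v A) (translate v B).
Proof. by rewrite !translateE; exact: ae_subset_affine. Qed.

Lemma ae_subset_dilate c A B : 0 < c ->
  ae_subset A B -> ae_subset (dilate c A) (dilate c B).
Proof. by rewrite !dilateE; exact: ae_subset_affine. Qed.

Lemma translate_translate (v w : 'rV[R]_n) A :
  translate v (translate w A) = translate (w + v) A.
Proof.
by rewrite /translate image_comp; apply: eq_imagel => x _ /=; rewrite addrA.
Qed.

Lemma dilate_dilate c d A : dilate c (dilate d A) = dilate (c * d) A.
Proof.
by rewrite /dilate image_comp; apply: eq_imagel => x _ /=; rewrite scalerA.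
Qed.

Lemma translate0 A : translate 0 A = A.
Proof. by apply: eq_image_id => x _; rewrite addr0. Qed.

Lemma dilate1 A : dilate 1 A = A.
Proof. by apply: eq_image_id => x _; rewrite scale1r. Qed.

Lemma translateI (v : 'rV[R]_n) A B :
  translate v (A `&` B) = translate v A `&` translate v B.
Proof. by rewrite !translateE !affine_imageE ?oner_eq0. Qed.

Lemma dilateI c A B : c != 0 -> dilate c (A `&` B) = dilate c A `&` dilate c B.
Proof. by move=> c0; rewrite !dilateE !affine_imageE. Qed.

Lemma dilateD c A B : c != 0 -> dilate c (A `\` B) = dilate c A `\` dilate c B.
Proof. by move=> c0; rewrite !dilateE !affine_imageE. Qed.

Lemma twopiD (v w : 'rV[int]_n) : twopi R (v + w) = twopi R v + twopi R w.
Proof. by rewrite /twopi map_mxD scalerDr. Qed.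

Lemma twopi0 : twopi R (0 : 'rV[int]_n) = 0.
Proof. by rewrite /twopi map_mx0 scaler0. Qed.

Lemma translation_congruent_two_pieces (v w : 'rV[int]_n) X Y A B :
  lebesgue_measurable X -> lebesgue_measurable Y ->
  lebesgue_null (X `&` Y) -> lebesgue_null (A `+` (X `|` Y)) ->
  lebesgue_null (translate (twopi R v) X `&` translate (twopi R w) Y) ->
  lebesgue_null (B `+` (translate (twopi R v) X `|` translate (twopi R w) Y)) ->
  translation_congruent A B.
Proof.
move=> mX mY XY AXY XY' BXY; exists (two_pieces v w X Y); split.
  exact: measurable_two_pieces.
rewrite (_ : (fun u => _) =
    two_pieces v w (translate (twopi R v) X) (translate (twopi R w) Y)).
  by apply: measurable_two_pieces => //; exact: measurable_translate.
by apply/funext => u; exact: (image_two_pieces (fun u x => x + twopi R u)).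
Qed.

Lemma dilation_congruent_two_pieces (j k : int) X Y A B :
  lebesgue_measurable X -> lebesgue_measurable Y ->
  lebesgue_null (X `&` Y) -> lebesgue_null (A `+` (X `|` Y)) ->
  lebesgue_null (dilate (2 ^ j) X `&` dilate (2 ^ k) Y) ->
  lebesgue_null (B `+` (dilate (2 ^ j) X `|` dilate (2 ^ k) Y)) ->
  dilation_congruent A B.
Proof.
move=> mX mY XY AXY XY' BXY; exists (two_pieces j k X Y); split.
  exact: measurable_two_pieces.
rewrite (_ : (fun u => _) =
    two_pieces j k (dilate (2 ^ j) X) (dilate (2 ^ k) Y)).
  by apply: measurable_two_pieces => //; apply: measurable_dilate => //;
    exact: exprz_gt0.
by apply/funext => u; exact: (image_two_pieces (fun u x => 2 ^ u *: x)).
Qed.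

End translations_and_dilations.

(** * The set [G] and its two congruences *)

Theorem lemma5 (R : realType) (n : nat) (E F : set 'rV[R]_n)
  (n1 n2 : 'rV[int]_n) (k1 k2 : int) :
  lebesgue_measurable E -> lebesgue_measurable F ->
  (0 < lebesgue_rV R n E < +oo)%E -> (0 < lebesgue_rV R n F < +oo)%E ->
  ae_subset (dilate (2 ^ k1) F) (translate (twopi R n1) E) ->
  ae_subset (translate (twopi R n2) E) (dilate (2 ^ k2) F) ->
  lebesgue_null (translate (twopi R n2) E `&` dilate (2 ^ k1) F) ->
  let S (x : 'rV[R]_n) := (2 : R) ^ (k1 - k2) *: (x + twopi R (n2 - n1)) in
  let C := dilate (2 ^ k1) F `\`
           dilate (2 ^ (k1 - k2)) (translate (twopi R n2) E) in
  let G0 :=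
    (\bigcup_i (iter i S @` C)) `|`
    (translate (twopi R n2) E `\`
     \bigcup_(i in [set i | (1 <= i)%N]) dilate (2 ^ (k2 - k1)) (iter i S @` C))
  in
  let good (G : set 'rV[R]_n) :=
    [/\ lebesgue_measurable G,
        ae_subset G (translate (twopi R n2) E `|` dilate (2 ^ k1) F),
        translation_congruent G E &
        dilation_congruent G F] in
  (exists G, good G) /\ good G0.
Proof.
move=> mE mF _ _ BA0 AB0 AB_null S C G0 good.
suff gG : good G0 by split => //; exists G0.
set A := translate (twopi R n2) E in AB0 AB_null C G0 good *.
set B := dilate (2 ^ k1) F in BA0 AB_null C G0 good *.
set c : R := 2 ^ (k1 - k2) in S C G0 good *.
set t := twopi R (n2 - n1) in S C G0 good *.
have p2 (k : int) : 0 < (2 : R) ^ k by exact: exprz_gt0.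
have p2D (j k : int) : (2 : R) ^ j * 2 ^ k = 2 ^ (j + k) by rewrite -expfzDr.
have c0 : 0 < c := p2 _.
have cN0 : c != 0 by rewrite gt_eqF.
have cV : 2 ^ (k2 - k1) = c^-1 by rewrite /c invr_expz opprB.
have BA : ae_subset (translate t B) A.
  have -> : A = translate t (translate (twopi R n1) E).
    by rewrite translate_translate -twopiD addrC subrK.
  exact: ae_subset_translate.
have AB : ae_subset (dilate c A) B.
  have -> : B = dilate c (dilate (2 ^ k2) F) by rewrite dilate_dilate p2D subrK.
  exact: ae_subset_dilate.
have mA : lebesgue_measurable A by exact: measurable_translate.
have mB : lebesgue_measurable B by exact: measurable_dilate.
have mC : lebesgue_measurable C.
  by apply: measurableD => //; exact: measurable_dilate.
have SE X : S @` X = dilate c (translate t X).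
  by rewrite /dilate /translate image_comp.
have iterE i : iter i.+1 S @` C = S @` (iter i S @` C).
  by rewrite image_comp.
pose D := \bigcup_i (iter i S @` C).
have mD : lebesgue_measurable D.
  apply: bigcupT_measurable; elim=> [|i IH]; first by rewrite image_id.
  by rewrite iterE; exact: measurable_affine.
(* Inductively, modulo null sets, [S] maps a subset of [B] into the dilate by [c] of
   [translate t B], hence into [dilate c A], hence into [B]. *)
have DB : ae_subset D B.
  apply: bigcup_ae_subset; elim=> [|i IH].
    by rewrite image_id; apply: subset_ae_subset => x [].
  rewrite iterE SE; apply: ae_subset_trans AB; apply: ae_subset_dilate => //.
  by apply: ae_subset_trans BA; exact: ae_subset_translate.
(* The term of index 0 is [C], and the remaining terms are the image of [D] under [S]. This equality
   is exact, not only modulo null sets. *)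
have DE : D = C `|` dilate c (translate t D).
  rewrite -SE image_bigcup; apply/seteqP; split.
    move=> x [[|i] _]; first by rewrite image_id => Cx; left.
    by rewrite iterE => Sx; right; exists i.
  move=> x [Cx|[i _ Sx]]; first by exists 0%N => //; rewrite image_id.
  by exists i.+1 => //; rewrite iterE.
pose H := A `\` translate t D.
have G0E : G0 = D `|` H.
  congr (_ `|` (_ `\` _)); rewrite [RHS]/translate image_bigcup cV.
  (* The factor [c^-1] cancels the last scaling in the iterate of index [i.+1], so the union over
     indices from 1 on becomes a union over all indices. *)
  have tE i : dilate c^-1 (iter i.+1 S @` C) = translate t (iter i S @` C).
    by rewrite iterE SE dilate_dilate mulVf// dilate1.
  apply/seteqP; split=> x; first by move=> [[//|i] _]; rewrite tE => ?; exists i.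
  by move=> [i _ ?]; exists i.+1 => //; rewrite tE.
have mH : lebesgue_measurable H.
  by apply: measurableD => //; exact: measurable_translate.
(* Here the null intersection of [A] and [B] enters: [D] is almost contained in [B], and [H] lies in
   [A]. *)
have DH : lebesgue_null (D `&` H).
  apply: negligibleS (negligibleU DB AB_null) => x [Dx [Ax _]].
  by have [Bx|nBx] := pselect (B x); [right|left].
have GDH : lebesgue_null (G0 `+` (D `|` H)).
  by rewrite G0E setYK; exact: negligible_set0.
split.
- by rewrite G0E; exact: measurableU.
- rewrite G0E; apply: ae_subsetU.
    by apply: ae_subset_trans DB _; apply: subset_ae_subset => x; right.
  by apply: subset_ae_subset => x [Ax _]; left.
(* Since [- n1 = (n2 - n1) - n2], moving [D] by [- n1] and [H] by [- n2] amounts to applying [t] to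
   [D] and then carrying both pieces back from [A] to [E]. *)
- have tD : translate (twopi R (- n1)) D = translate (twopi R (- n2)) (translate t D).
    by rewrite translate_translate -twopiD addrAC subrr add0r.
  have EA : E = translate (twopi R (- n2)) A.
    by rewrite translate_translate -twopiD subrr twopi0 translate0.
  apply: (@translation_congruent_two_pieces _ _ (- n1) (- n2) D H) => //; rewrite tD.
    by rewrite -translateI setDIK /translate image_set0; exact: negligible_set0.
  rewrite [in X in X `+` _]EA /translate -image_setU.
  apply: ae_subset_setY; apply: ae_subset_translate.
    apply: subset_ae_subset => x Ax.
    by have [Dx|nDx] := pselect (translate t D x); [left|right].
  apply: ae_subsetU; last by apply: subset_ae_subset => x [].
  by apply: ae_subset_trans BA; exact: ae_subset_translate.
(* Likewise, [- k2 = - k1 + (k1 - k2)]: [H] is first scaled by [c], and then both pieces are carried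
   from [B] to [F]. *)
- have cH : dilate (2 ^ (- k2)) H = dilate (2 ^ (- k1)) (dilate c H).
    by rewrite dilate_dilate p2D addrA addNr add0r.
  have FB : F = dilate (2 ^ (- k1)) B.
    by rewrite dilate_dilate p2D addNr expr0z dilate1.
  have cHE : dilate c H = dilate c A `\` dilate c (translate t D).
    exact: dilateD.
  apply: (@dilation_congruent_two_pieces _ _ (- k1) (- k2) D H) => //; rewrite cH.
    rewrite -dilateI ?gt_eqF// (_ : D `&` _ = set0).
      by rewrite /dilate image_set0; exact: negligible_set0.
    (* By [DE], a point of [D] is either in [C], thus outside [dilate c A], or in the part
       [dilate c (translate t D)] that is removed from [dilate c H]. *)
    rewrite cHE; apply/seteqP; split=> // x [+ [Ax nDx]].
    by rewrite DE => -[[_ nAx]|Dx]; [exact: nAx Ax|exact: nDx Dx].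
  rewrite [in X in X `+` _]FB /dilate -image_setU.
  apply: ae_subset_setY; apply: ae_subset_dilate => //.
    (* Points of [B] outside [dilate c A] form [C]; those inside are split by membership in
       [dilate c (translate t D)]. *)
    apply: subset_ae_subset => x Bx; rewrite -/(dilate c H) cHE {1}DE.
    have [Ax|nAx] := pselect (dilate c A x); last by left; left.
    by have [Dx|nDx] := pselect (dilate c (translate t D) x); [left; right|right].
  apply: ae_subsetU => //; apply: ae_subset_trans AB.
  by apply: ae_subset_dilate => //; apply: subset_ae_subset => x [].
Qed.
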